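(* Let $n$ be an odd positive integer. Then $$G = -T\left(\frac14\right) = \frac{2n+1}{n+1}\sum_{j=1}^n (-1)^j\, T\left(\frac{2j-1}{8n+4}\right).$$
   Context: Catalan's constant is $G := \sum_{k=0}^\infty \frac{(-1)^k}{(2k+1)^2}$. For real $r$ with $0\le r\le \tfrac12$, $T(r) := \int_0^{r\pi}\log(\tan\theta)\,d\theta$ (the integrand has integrable logarithmic singularities at $0$ and $\pi/2$). *)

(* Defs.v *)
From HB Require Import structures.
From mathcomp Require Import all_boot all_order all_algebra.
From mathcomp Require Import all_classical all_reals all_analysis.

Set Implicit Arguments.
Unset Strict Implicit.
Unset Printing Implicit Defensive.

Import Order.TTheory GRing.Theory Num.Theory.
Import numFieldNormedType.Exports.

Local Open Scope classical_set_scope.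
Local Open Scope ring_scope.

Definition catalan (R : realType) : R :=
  limn (series (fun k : nat => (-1) ^+ k / (2 * k%:R + 1) ^+ 2 : R)).

(* Lebesgue integral, meaningful for 0 <= r <= 1/2: the logarithmic
   singularities at 0 and pi/2 are integrable, and the conventional values
   of the integrand at those two points do not affect it. *)
Definition logtan_integral (R : realType) (r : R) : R :=
  \int[@lebesgue_measure R]_(t in `[0, r * pi]) ln (tan t).

(* Main.v *)
Require Import Defs.
From HB Require Import structures.
From mathcomp Require Import all_boot all_order all_algebra.
From mathcomp Require Import all_classical all_reals all_analysis.
From mathcomp Require Import measurable_realfun ring lra zify.

(** Why the theorem holds. On [0 < x <= pi / 4] the primitive of [ln (tan t)]
    has the Fourier expansion
      [\int_0^x ln (tan t) dt = - \sum_k sin ((4 k + 2) x) / (2 k + 1) ^ 2],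
    written [Rintegral_ln_tan] below, with [odd_clausen] for the sum of the
    series. At [x = pi / 4] the sines are the signs [(-1) ^ k], which is the
    first equality.

    For the second one put [N = 2 n + 1]. The sample points of the finite sum
    are [(2 j - 1) * pi / (4 N)], so the coefficient of [1 / (2 k + 1) ^ 2] in
    the alternating sum of the values of [odd_clausen] is the alternating sum
    over [j] of [sin ((2 j - 1) * phi)] with [phi = (2 k + 1) * pi / (2 N)].
    That sum telescopes after multiplication by [2 * cos phi] and equals
    [(-1) ^ n * (-1) ^ k / 2], unless [N] divides [2 k + 1]. In the latter case
    it differs from this value by [- (-1) ^ n * (n + 1 / 2) * (-1) ^ k]. The
    exceptional indices satisfy [2 k + 1 = N * (2 i + 1)] and hence again run
    through the series of Catalan's constant [G], scaled by [1 / N ^ 2]. Adding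
    up ([sum_odd_clausen]), the alternating sum of the values of [odd_clausen]
    is [((-1) ^ n / 2 - 1 / (2 N)) * G], which for odd [n] is
    [- (n + 1) / (2 n + 1) * G].

    The expansion itself is proved without Fourier theory. The partial sums of
    the differentiated series differ from [ln (tan x)] by a function that
    vanishes at [pi / 4] and has derivative [2 * cos (4 K x) / sin (2 x)]. One
    integration by parts bounds it by [2 / (K * sin (2 a) ^ 2)] on
    [[a, pi / 4]] ([logtan_error_le]). Integrating over [[a, x]] and letting [K]
    grow gives the integral over that segment ([Rintegral_ln_tan_itv]). Then [a]
    tends to [0] by monotone convergence, since [ln (tan t)] is nonpositive. *)

Set Implicit Arguments.
Unset Strict Implicit.
Unset Printing Implicit Defensive.

Import Order.TTheory GRing.Theory Num.Theory.
Import numFieldNormedType.Exports.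

Local Open Scope classical_set_scope.
Local Open Scope ring_scope.

(** * The sine series *)

Section Series.
Context {R : realType}.
Implicit Types (x : R) (k K L : nat).

Definition odd_clausen_term x k : R :=
  sin ((4 * k%:R + 2) * x) / (2 * k%:R + 1) ^+ 2.

(** The odd-index part of the Clausen function [Cl_2] at [2 x]; up to sign it
    is the Fourier series of the primitive of [ln (tan t)]. *)
Definition odd_clausen x : R := limn (series (odd_clausen_term x)).

Lemma odd_gt0 k : 0 < 2 * k%:R + 1 :> R.
Proof. by rewrite ltr_wpDl// mulr_ge0. Qed.

(** A telescoping majorant replaces the comparison with [1 / k ^ 2], so that
    convergence and an explicit tail bound, uniform in [x], come together. *)
Lemma odd_clausen_term_le x k :
  `|odd_clausen_term x k| <= 2 / k.+1%:R - 2 / k.+2%:R.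
Proof.
have k0 : 0 <= k%:R :> R by [].
rewrite normrM normfV (ger0_norm (exprn_ge0 _ (ltW (odd_gt0 k)))).
apply: (@le_trans _ _ (1 / (2 * k%:R + 1) ^+ 2)).
  by rewrite ler_pM2r ?invr_gt0 ?exprn_gt0 ?odd_gt0// sin_max.
have -> : 2 / k.+1%:R - 2 / k.+2%:R = 2 / ((k%:R + 1) * (k%:R + 2)) :> R.
  rewrite -(addn2 k) -(addn1 k) !natrD.
  by field; rewrite !gt_eqF// ltr_wpDl.
rewrite ler_pdivrMr ?exprn_gt0 ?odd_gt0// mulrAC ler_pdivlMr; last first.
  by rewrite mulr_gt0// ltr_wpDl.
by nra.
Qed.

Lemma sum_norm_odd_clausen_term_le x K L : (K <= L)%N ->
  \sum_(K <= k < L) `|odd_clausen_term x k| <= 2 / K.+1%:R.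
Proof.
move=> KL.
apply: (@le_trans _ _ (\sum_(K <= k < L) (2 / k.+1%:R - 2 / k.+2%:R))).
  by apply: ler_sum => k _; exact: odd_clausen_term_le.
rewrite -[X in X <= _]opprK -sumrN.
under eq_bigr do rewrite opprB.
rewrite (telescope_sumr (fun k => 2 / k.+1%:R))// opprB.
by rewrite lerBlDr lerDl divr_ge0.
Qed.

Lemma odd_clausen_tail x K L : (K <= L)%N ->
  `|series (odd_clausen_term x) L - series (odd_clausen_term x) K| <=
  2 / K.+1%:R.
Proof.
move=> KL; rewrite /series/= sub_series_geq//.
exact: (le_trans (ler_norm_sum _ _ _) (sum_norm_odd_clausen_term_le _ KL)).
Qed.

Lemma is_cvg_odd_clausen x : cvgn (series (odd_clausen_term x)).
Proof.
apply: normed_cvg; apply: nondecreasing_is_cvgn.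
  by apply: nondecreasing_series => k _ _; exact: normr_ge0.
exists 2 => _ [L _ <-] /=.
by have := sum_norm_odd_clausen_term_le x (leq0n L); rewrite divr1.
Qed.

Lemma cvg_odd_clausen x : series (odd_clausen_term x) @ \oo --> odd_clausen x.
Proof. exact: is_cvg_odd_clausen. Qed.

Lemma odd_clausen_approx x K :
  `|odd_clausen x - series (odd_clausen_term x) K| <= 2 / K.+1%:R.
Proof.
have h : `|series (odd_clausen_term x) L - series (odd_clausen_term x) K|
    @[L --> \oo] --> `|odd_clausen x - series (odd_clausen_term x) K|.
  by apply: cvg_norm; apply: cvgB; [exact: cvg_odd_clausen|exact: cvg_cst].
apply: (cvgr_to_le h); exists K => // L /= KL; exact: odd_clausen_tail.
Qed.

End Series.

(** * Alternating sums of sines *)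

Section AlternatingSineSum.
Context {R : realType}.
Implicit Types (y phi : R) (n k q M : nat).

(** Multiplying by [2 * cos phi] turns each sine into a sum of two neighbouring
    sines of even multiples of [phi], and the alternating signs telescope. *)
Lemma alternating_sin_sum phi n :
  2 * cos phi * (\sum_(1 <= j < n.+1) (-1) ^+ j * sin ((2 * j%:R - 1) * phi)) =
  (-1) ^+ n * sin (2 * n%:R * phi).
Proof.
elim: n => [|n IH]; first by rewrite big_nil mulr0 mulr0 mul0r sin0 mulr0.
rewrite big_nat_recr//= mulrDr IH exprS mulN1r.
have e1 : 2 * n%:R * phi = (2 * n.+1%:R - 1) * phi - phi.
  by rewrite -(addn1 n) natrD; ring.
have e2 : 2 * n.+1%:R * phi = (2 * n.+1%:R - 1) * phi + phi by ring.
rewrite e1 e2 sinB sinD; ring.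
Qed.

(** Both functions are carried along because a quarter turn exchanges them. *)
Lemma sin_cos_quarter_neq0 y q : 0 < y < pi / 2 ->
  sin (y + q%:R * (pi / 2)) != 0 /\ cos (y + q%:R * (pi / 2)) != 0.
Proof.
move=> /andP[y0 y1]; elim: q => [|q [IHs IHc]].
  rewrite mul0r addr0 !gt_eqF// ?sin_gt0_pihalf ?y0//.
  rewrite cos_gt0_pihalf// y1 andbT (lt_trans _ y0)//.
  by rewrite oppr_lt0 divr_gt0// pi_gt0.
have -> : y + q.+1%:R * (pi / 2) = y + q%:R * (pi / 2) + pi / 2.
  by rewrite -(addn1 q) natrD; ring.
by rewrite sinDpihalf cosDpihalf oppr_eq0.
Qed.

Lemma sin_odd_pihalf k : sin ((2 * k%:R + 1) * (pi / 2)) = (-1) ^+ k :> R.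
Proof.
elim: k => [|k IH]; first by rewrite mulr0 add0r mul1r sin_pihalf.
rewrite exprS -IH mulN1r -sinDpi; congr sin.
by rewrite -(addn1 k) natrD; field.
Qed.

Lemma cos_odd_pihalf k : cos ((2 * k%:R + 1) * (pi / 2)) = 0 :> R.
Proof.
elim: k => [|k IH]; first by rewrite mulr0 add0r mul1r cos_pihalf.
rewrite -[RHS]oppr0 -IH -cosDpi; congr cos.
by rewrite -(addn1 k) natrD; field.
Qed.

(** With [phi = (2 k + 1) * pi / (2 N)] and [N = 2 n + 1], the angle [2 n * phi]
    is an odd multiple of [pi / 2] minus [phi], so the telescoped sum is a sign
    times [cos phi]; one may divide by [cos phi] because it vanishes only when
    [N] divides [2 k + 1]. *)
Lemma alternating_sin_sum_generic n k : ~~ (2 * n + 1 %| 2 * k + 1)%N ->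
  \sum_(1 <= j < n.+1) (-1) ^+ j *
    sin ((2 * k%:R + 1) * (2 * j%:R - 1) * (pi / (2 * (2 * n%:R + 1)))) =
  (-1) ^+ n * (-1) ^+ k / 2 :> R.
Proof.
move=> ndvd.
set phi : R := (2 * k%:R + 1) * (pi / (2 * (2 * n%:R + 1))).
have N0 : 0 < 2 * n%:R + 1 :> R by exact: odd_gt0.
have cphi : cos phi != 0.
  set N := (2 * n + 1)%N in ndvd *.
  set r := ((2 * k + 1) %% N)%N.
  have r0 : (0 < r)%N by rewrite lt0n.
  have rN : (r < N)%N by rewrite ltn_mod /N addn1.
  have NR : N%:R = 2 * n%:R + 1 :> R by rewrite /N natrD natrM.
  (* Euclidean division of 2 k + 1 by N: phi is an angle strictly inside the
     first quadrant plus a whole number of quarter turns. *)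
  have -> : phi = r%:R / N%:R * (pi / 2) + ((2 * k + 1) %/ N)%:R * (pi / 2).
    have : (2 * k + 1)%:R = 2 * k%:R + 1 :> R by rewrite natrD natrM.
    rewrite {1}(divn_eq (2 * k + 1) N) -/r natrD natrM /phi -NR => <-.
    by field; rewrite NR gt_eqF.
  apply: (proj2 (sin_cos_quarter_neq0 _ _)).
  have p0 : 0 < pi / 2 :> R by rewrite divr_gt0// pi_gt0.
  have q0 : 0 < r%:R / N%:R :> R by rewrite divr_gt0 ?ltr0n ?(ltn_trans r0 rN).
  rewrite mulr_gt0//= gtr_pMl// ltr_pdivrMr ?mul1r ?ltr_nat//.
  by rewrite ltr0n (ltn_trans r0 rN).
have := alternating_sin_sum phi n.
have -> : 2 * n%:R * phi = (2 * k%:R + 1) * (pi / 2) - phi.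
  by rewrite /phi; field; rewrite gt_eqF.
rewrite sinB cos_odd_pihalf sin_odd_pihalf mul0r subr0 => h.
have c2 : 2 * cos phi != 0 by rewrite mulf_neq0 ?pnatr_eq0.
apply: (mulfI c2).
rewrite [RHS](_ : _ = (-1) ^+ n * ((-1) ^+ k * cos phi)); last by field.
rewrite -h; congr (_ * _); apply: eq_bigr => j _; congr (_ * sin _).
by rewrite /phi; ring.
Qed.

(** The degenerate case [cos phi = 0]: here [phi = (2 i + 1) * pi / 2], and the
    signs of the sines cancel the alternation, so the [n] terms add up. *)
Lemma alternating_sin_sum_multiple n i :
  \sum_(1 <= j < n.+1) (-1) ^+ j *
    sin ((2 * i%:R + 1) * (2 * j%:R - 1) * (pi / 2)) =
  - n%:R * (-1) ^+ i :> R.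
Proof.
rewrite (eq_big_nat _ _ (F2 := fun=> - (-1) ^+ i)).
  by rewrite sumr_const_nat subn1/= mulNr mulr_natl mulNrn.
move=> [//|j] _.
have -> : (2 * i%:R + 1) * (2 * j.+1%:R - 1) =
   2 * (2 * i * j + i + j)%:R + 1 :> R.
  by rewrite -(addn1 j) !natrD !natrM; ring.
rewrite sin_odd_pihalf 2!exprD -mulnA exprM sqrrN !expr1n mul1r.
by rewrite exprS mulN1r mulNr mulrCA -expr2 sqrr_sign mulr1.
Qed.

(** In every block of [2 n + 1] consecutive indices exactly one, the one
    congruent to [n], makes [2 k + 1] a multiple of [2 n + 1]. *)
Lemma sum_odd_multiples n M (f : nat -> R) :
  \sum_(0 <= k < (2 * n + 1) * M | (2 * n + 1 %| 2 * k + 1)%N) f k =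
  \sum_(0 <= i < M) f (n + (2 * n + 1) * i)%N.
Proof.
elim: M => [|M IH]; first by rewrite muln0 !big_nil.
rewrite big_nat_recr//= -IH mulnS addnC.
rewrite (big_cat_nat (leq0n _) (leq_addr _ _))//=.
congr (_ + _).
have nN : (n < 2 * n + 1)%N by lia.
rewrite -{1}[((2 * n + 1) * M)%N]add0n big_addn addKn big_mkord.
rewrite (big_pred1 (Ordinal nN))// => l /=.
rewrite mulnDr mulnCA -addnA addnCA dvdn_addr ?dvdn_mulr//.
apply/idP/eqP => [/dvdnP[q]|-> //] => h; apply: val_inj => /=.
have := ltn_ord l; case: q h => [|[|q]]; nia.
Qed.

End AlternatingSineSum.

(** * Fourier approximation of the logarithm of the tangent *)

Section LogTan.
Context {R : realType}.
Implicit Types (x y a : R) (k K : nat).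

Definition fourier_logtan K x : R :=
  \sum_(0 <= k < K) - (2 / (2 * k%:R + 1)) * cos ((4 * k%:R + 2) * x).

Definition logtan_error K x : R := ln (tan x) - fourier_logtan K x.

Lemma sum_sin_odd K x :
  2 * sin (2 * x) * (\sum_(0 <= k < K) sin ((4 * k%:R + 2) * x)) =
  1 - cos (4 * K%:R * x).
Proof.
elim: K => [|K IH]; first by rewrite big_nil !(mulr0, mul0r) cos0 subrr.
rewrite big_nat_recr//= mulrDr IH.
have e1 : 4 * K%:R * x = (4 * K%:R + 2) * x - 2 * x by ring.
have e2 : 4 * K.+1%:R * x = (4 * K%:R + 2) * x + 2 * x.
  by rewrite -(addn1 K) natrD; ring.
by rewrite e1 e2 cosB cosD; ring.
Qed.

Lemma is_derive_scale_sin (c x : R) :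
  is_derive x 1 (fun t : R => sin (c * t)) (c * cos (c * x)).
Proof.
have -> : (fun t : R => sin (c * t)) = sin \o (c \*: id) by [].
by apply: is_derive_eq; rewrite /= mulrC /GRing.scale/= mulr1.
Qed.

Lemma is_derive_scale_cos (c x : R) :
  is_derive x 1 (fun t : R => cos (c * t)) (- c * sin (c * x)).
Proof.
have -> : (fun t : R => cos (c * t)) = cos \o (c \*: id) by [].
by apply: is_derive_eq; rewrite /= /GRing.scale/= mulr1; ring.
Qed.

Lemma is_derive_fourier_logtan K x :
  is_derive x 1 (fourier_logtan K)
    (4 * \sum_(0 <= k < K) sin ((4 * k%:R + 2) * x)).
Proof.
elim: K => [|K IH].
  rewrite big_nil mulr0 (_ : fourier_logtan 0 = cst 0).
    exact: is_derive_cst.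
  by apply: funext => t; rewrite /fourier_logtan big_nil.
rewrite big_nat_recr//= mulrDr.
have -> : fourier_logtan K.+1 = fourier_logtan K +
    (- (2 / (2 * K%:R + 1)) \*: (fun t : R => cos ((4 * K%:R + 2) * t))).
  by apply: funext => t; rewrite /fourier_logtan big_nat_recr.
have dc := is_derive_scale_cos (4 * K%:R + 2) x.
apply: is_derive_eq; rewrite /GRing.scale/=; congr (_ + _).
by field; rewrite gt_eqF// odd_gt0.
Qed.

Lemma is_derive_odd_clausen_series K x :
  is_derive x 1 (fun t : R => series (odd_clausen_term t) K)
    (- fourier_logtan K x).
Proof.
elim: K => [|K IH].
  rewrite /fourier_logtan big_nil oppr0.
  have -> : (fun t : R => series (odd_clausen_term t) 0%N) = cst (0 : R).
    by apply: funext => t; rewrite /series/= big_nil.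
  exact: is_derive_cst.
rewrite /fourier_logtan big_nat_recr//= opprD -/(fourier_logtan K x).
have -> : (fun t : R => series (odd_clausen_term t) K.+1) =
    (fun t : R => series (odd_clausen_term t) K) +
    (((2 * K%:R + 1) ^+ 2)^-1 \*: (fun t : R => sin ((4 * K%:R + 2) * t))).
  apply: funext => t; rewrite /series/= big_nat_recr//=; congr (_ + _).
  by rewrite /odd_clausen_term /GRing.scale/= mulrC.
have dc := is_derive_scale_sin (4 * K%:R + 2) x.
apply: is_derive_eq; rewrite /GRing.scale/=; congr (_ + _).
by field; rewrite gt_eqF// odd_gt0.
Qed.

(** The partial sums vanish continuously at [0] and the tail is uniformly
    small. *)
Lemma odd_clausen_cvg0 : odd_clausen x @[x --> (0 : R)] --> (0 : R).
Proof.
apply/cvgr0Pnorm_lt => e e0.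
have [K Ke] : exists K : nat, 2 / K.+1%:R < e / 2.
  have [K _ /(_ K (leqnn K)) h] :
      \forall K \near \oo, 2 * harmonic K < e / 2 :> R.
    have : (2 * harmonic K : R) @[K --> \oo] --> (2 * 0 : R).
      by apply: cvgMr; exact: cvg_harmonic.
    by rewrite mulr0 => /cvgr_lt; apply; rewrite divr_gt0.
  by exists K.
have S0 : (series (odd_clausen_term x) K : R) @[x --> 0] --> (0 : R).
  have dS : derivable (fun t : R => series (odd_clausen_term t) K) 0 1.
    by have [] := is_derive_odd_clausen_series K 0.
  have := differentiable_continuous ((derivable1_diffP _ _).1 dS).
  rewrite /prop_for /continuous_at /= [X in _ --> X](_ : _ = 0)//.
  rewrite /series/= big1// => k _.
  by rewrite /odd_clausen_term mulr0 sin0 mul0r.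
have e20 : 0 < e / 2 by rewrite divr_gt0.
near=> x.
have : `|series (odd_clausen_term x) K| < e / 2.
  by near: x; exact: (cvgr0_norm_lt _ S0).
move=> h1; have h2 := odd_clausen_approx x K.
have -> : odd_clausen x = (odd_clausen x - series (odd_clausen_term x) K) +
  series (odd_clausen_term x) K by rewrite subrK.
apply: (le_lt_trans (ler_normD _ _)); rewrite (splitr e).
by apply: ler_ltD => //; apply: (le_trans h2); exact: ltW.
Unshelve. all: by end_near. Qed.

Lemma octant_bounds x : 0 < x <= pi / 4 ->
  [/\ 0 < sin x, 0 < cos x & 0 < sin (2 * x)].
Proof.
have p0 := @pi_gt0 R.
move=> /andP[x0 x1]; split.
- by rewrite sin_gt0_pihalf// x0/=; lra.
- by rewrite cos_gt0_pihalf//; apply/andP; split; lra.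
- by rewrite sin_gt0_pi//; apply/andP; split; lra.
Qed.

Lemma tan_gt0_octant x : 0 < x <= pi / 4 -> 0 < tan x.
Proof. by move=> /octant_bounds[s0 c0 _]; rewrite divr_gt0. Qed.

Lemma is_derive_ln_tan x : 0 < x <= pi / 4 ->
  is_derive x 1 (fun t : R => ln (tan t)) (2 / sin (2 * x)).
Proof.
move=> x01; have [s0 c0 s20] := octant_bounds x01.
have dt : is_derive x 1 tan ((cos x)^-2).
  by apply: is_derive_tan; rewrite gt_eqF.
have dl : is_derive (tan x) 1 (@ln R) (tan x)^-1.
  exact: is_derive1_ln (tan_gt0_octant x01).
have d := @is_derive1_comp R (@ln R) tan x _ _ dl dt.
apply: (is_derive_eq d).
rewrite /tan (mulr_natl x 2) sin_mulr2n.
by field; rewrite !gt_eqF.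
Qed.

(** The derivatives of [ln (tan x)] and of the Fourier sum are [2 / sin (2 x)]
    and [2 * (1 - cos (4 K x)) / sin (2 x)]; only the oscillating part is
    left. *)
Lemma is_derive_logtan_error K x : 0 < x <= pi / 4 ->
  is_derive x 1 (logtan_error K) (2 * cos (4 * K%:R * x) / sin (2 * x)).
Proof.
move=> x01; have [s0 c0 s20] := octant_bounds x01.
have d1 := is_derive_ln_tan x01.
have d2 := is_derive_fourier_logtan K x.
have -> : logtan_error K = (fun t : R => ln (tan t)) - fourier_logtan K by [].
apply: is_derive_eq.
have := sum_sin_odd K x.
set S := \sum_(_ <= _ < _) _ => h.
have -> : cos (4 * K%:R * x) = 1 - 2 * sin (2 * x) * S by rewrite h; ring.
by field; rewrite gt_eqF.
Qed.

(** [ln (tan x)] and every term of the Fourier sum vanish at [pi / 4], which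
    fixes the constant of integration. *)
Lemma logtan_error_piquarter K : logtan_error K (pi / 4) = 0.
Proof.
rewrite /logtan_error tan_piquarter ln1 /fourier_logtan big1 ?subrr// => k _.
have -> : (4 * k%:R + 2) * (pi / 4) = (2 * k%:R + 1) * (pi / 2) :> R by field.
by rewrite cos_odd_pihalf mulr0.
Qed.

Lemma sin_natpi K : sin (K%:R * pi) = 0 :> R.
Proof.
elim: K => [|K IH]; first by rewrite mul0r sin0.
by rewrite -(addn1 K) natrD mulrDl mul1r sinDpi IH oppr0.
Qed.

(** The derivative of the error oscillates but does not tend to [0]. Subtracting
    the boundary term of one integration by parts leaves a function whose
    derivative is [O(1 / K)] away from [0]. *)
Definition logtan_corrected K x : R :=
  logtan_error K x - sin (4 * K%:R * x) / (2 * K%:R * sin (2 * x)).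

Lemma is_derive_logtan_corrected K x : (0 < K)%N -> 0 < x <= pi / 4 ->
  is_derive x 1 (logtan_corrected K)
    (sin (4 * K%:R * x) * cos (2 * x) / (K%:R * sin (2 * x) ^+ 2)).
Proof.
move=> K0 x01; have [s0 c0 s20] := octant_bounds x01.
have KR : K%:R != 0 :> R by rewrite pnatr_eq0 -lt0n.
have d1 := is_derive_logtan_error K x01.
have d2 := is_derive_scale_sin (4 * K%:R) x.
have d3 := is_derive_scale_sin 2 x.
have d4 : is_derive x 1 (fun t : R => (sin (2 * t))^-1)
    (- (sin (2 * x)) ^- 2 *: (2 * cos (2 * x))).
  by apply: is_deriveV => //; rewrite gt_eqF.
have -> : logtan_corrected K = logtan_error K -
   ((2 * K%:R)^-1 \*: ((fun t : R => sin (4 * K%:R * t)) *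
      (fun t : R => (sin (2 * t))^-1))).
  apply: funext => t; rewrite /logtan_corrected /=; congr (_ - _).
  by rewrite invfM mulrCA.
apply: is_derive_eq.
rewrite /GRing.scale/=; field; rewrite KR gt_eqF//.
Qed.

(** The mean value theorem for the corrected error between [x] and [pi / 4],
    where it vanishes. The constant [2] is [1] for the boundary term plus [1]
    for the remainder, as [pi / 4 - x <= 1]. *)
Lemma logtan_error_le a x K : (0 < K)%N -> 0 < a -> a <= x <= pi / 4 ->
  `|logtan_error K x| <= 2 / (K%:R * sin (2 * a) ^+ 2).
Proof.
move=> K0 a0 /andP[ax x1].
have p0 := @pi_gt0 R.
have KR : 0 < K%:R :> R by rewrite ltr0n.
have in_oct y : x <= y <= pi / 4 -> 0 < y <= pi / 4.
  by move=> /andP[xy ->]; rewrite (lt_le_trans a0)// (le_trans ax).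
have sa0 : 0 < sin (2 * a).
  by have /octant_bounds[] : 0 < a <= pi / 4 by rewrite a0 (le_trans ax).
have sa y : x <= y <= pi / 4 -> sin (2 * a) <= sin (2 * y).
  move=> /andP[xy y1]; rewrite leNgt ltr_sin -?leNgt ?in_itv/=.
  - by lra.
  - by apply/andP; split; lra.
  - by apply/andP; split; lra.
have dg y : y \in `]x, pi / 4[ -> is_derive y 1 (logtan_corrected K)
    (sin (4 * K%:R * y) * cos (2 * y) / (K%:R * sin (2 * y) ^+ 2)).
  rewrite in_itv/= => /andP[xy y1].
  by apply: is_derive_logtan_corrected => //; apply: in_oct; rewrite !ltW.
have cg : {within `[x, pi / 4], continuous (logtan_corrected K)}.
  apply: derivable_within_continuous => y; rewrite in_itv/= => /in_oct xy.
  by have [] := is_derive_logtan_corrected K0 xy.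
have [c cx] := MVT_segment x1 dg cg.
rewrite in_itv/= in cx.
have -> : logtan_corrected K (pi / 4) = 0.
  rewrite /logtan_corrected logtan_error_piquarter.
  have -> : 4 * K%:R * (pi / 4) = K%:R * pi :> R by field.
  by rewrite sin_natpi mul0r subrr.
rewrite sub0r {1}/logtan_corrected => E.
have -> : logtan_error K x = sin (4 * K%:R * x) / (2 * K%:R * sin (2 * x)) -
  sin (4 * K%:R * c) * cos (2 * c) / (K%:R * sin (2 * c) ^+ 2) * (pi / 4 - x).
  by rewrite -E; ring.
apply: (le_trans (ler_normB _ _)).
have sx := sa x; rewrite lexx x1 in sx; have {}sx := sx isT.
have sc := sa c cx.
have pi4 : pi / 4 <= 1 :> R by have := @pihalf_lt2 R; lra.
set D := K%:R * sin (2 * a) ^+ 2.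
have D0 : 0 < D by rewrite mulr_gt0// exprn_gt0.
have -> : 2 / D = 1 / D + 1 / D by lra.
apply: lerD.
  rewrite normrM normfV [X in _ / X <= _]gtr0_norm; last first.
    by rewrite !mulr_gt0// (lt_le_trans sa0).
  apply: ler_pM => //.
  - by rewrite invr_ge0 !mulr_ge0// ltW// (lt_le_trans sa0).
  - exact: sin_max.
  rewrite lef_pV2 ?posrE// ?mulr_gt0// ?(lt_le_trans sa0)//.
  have -> : 2 * K%:R * sin (2 * x) = K%:R * (2 * sin (2 * x)) by ring.
  rewrite /D ler_wpM2l ?ler0n//.
  by have := sin_le1 (2 * a); nra.
rewrite normrM -[X in _ <= X]mulr1; apply: ler_pM => //; last first.
  by rewrite ger0_norm; lra.
rewrite normrM normfV [X in _ / X <= _]gtr0_norm; last first.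
  by rewrite !mulr_gt0// ?exprn_gt0// (lt_le_trans sa0).
apply: ler_pM => //.
- by rewrite invr_ge0 mulr_ge0 ?sqr_ge0.
- rewrite normrM -[X in _ <= X]mulr1; apply: ler_pM => //.
    exact: sin_max.
  exact: cos_max.
- rewrite lef_pV2 ?posrE// ?mulr_gt0// ?exprn_gt0// ?(lt_le_trans sa0)//.
  by rewrite ler_pM2l// ler_pXn2r// ?nnegrE ltW// (lt_le_trans sa0).
Qed.

End LogTan.

(** * The integral of the logarithm of the tangent *)

Section Integral.
Context {R : realType}.
Implicit Types (x a : R) (K : nat).
Let mu := @lebesgue_measure R.

Lemma continuous_ln_tan_within (i : interval R) :
  [set` i] `<=` `]0, pi / 4] ->
  {within [set` i], continuous (fun t : R => ln (tan t))}.
Proof.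
move=> i01; apply: derivable_within_continuous => t /i01/=.
by rewrite in_itv/= => /is_derive_ln_tan[].
Qed.

Lemma continuous_fourier_logtan K : continuous (@fourier_logtan R K).
Proof.
move=> t; have [dF _] := is_derive_fourier_logtan K t.
exact: (differentiable_continuous ((derivable1_diffP _ _).1 dF)).
Qed.

Lemma continuous_odd_clausen_series K :
  continuous (fun t : R => series (odd_clausen_term t) K).
Proof.
move=> t; have [dF _] := is_derive_odd_clausen_series K t.
exact: (differentiable_continuous ((derivable1_diffP _ _).1 dF)).
Qed.

Lemma Rintegral_fourier_logtan K a x : a < x ->
  \int[mu]_(t in `[a, x]) fourier_logtan K t =
  series (odd_clausen_term a) K - series (odd_clausen_term x) K.
Proof.
move=> ax; rewrite /Rintegral.
have cS := @continuous_odd_clausen_series K.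
rewrite (@continuous_FTC2 _ _
  (fun t : R => - series (odd_clausen_term t) K))//=.
- by rewrite opprK addrC.
- exact/continuous_subspaceT/continuous_fourier_logtan.
- split => [t _||].
  + by apply: derivableN; have [] := is_derive_odd_clausen_series K t.
  + by apply: cvgN; apply: cvg_at_right_filter; exact: cS.
  + by apply: cvgN; apply: cvg_at_left_filter; exact: cS.
- move=> t _; rewrite derive1E.
  have dF := is_derive_odd_clausen_series K t.
  by rewrite deriveN ?derive_val ?opprK.
Qed.

Lemma integrable_itvcc (f : R -> R) a x : {within `[a, x], continuous f} ->
  mu.-integrable `[a, x] (EFin \o f).
Proof.
move=> cf; apply: continuous_compact_integrable => //.
exact: segment_compact.
Qed.

(** The difference is the integral of the error, which is uniformly small on a
    segment that avoids the singularity. *)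
Lemma Rintegral_ln_tan_approx K a x :
  (0 < K)%N -> 0 < a -> a < x -> x <= pi / 4 ->
  `|\int[mu]_(t in `[a, x]) ln (tan t) -
    (series (odd_clausen_term a) K - series (odd_clausen_term x) K)| <=
  2 / (K%:R * sin (2 * a) ^+ 2) * (x - a).
Proof.
move=> K0 a0 ax x1.
have il : mu.-integrable `[a, x] (EFin \o (fun t : R => ln (tan t))).
  apply/integrable_itvcc/continuous_ln_tan_within/subset_itv;
    by rewrite bnd_simp.
have iF : mu.-integrable `[a, x] (EFin \o fourier_logtan K).
  exact/integrable_itvcc/continuous_subspaceT/continuous_fourier_logtan.
have ie : mu.-integrable `[a, x] (EFin \o logtan_error K).
  have -> : EFin \o logtan_error K = ((EFin \o (fun t : R => ln (tan t))) \-
    (EFin \o fourier_logtan K))%E by [].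
  exact: integrableB.
rewrite -Rintegral_fourier_logtan// -RintegralB//.
apply: (le_trans (le_normr_Rintegral _ _)) => //.
set c := 2 / _.
have -> : c * (x - a) = \int[mu]_(t in `[a, x]) c.
  rewrite Rintegral_cst//; congr (_ * _).
  by rewrite /mu/= lebesgue_measure_itv/= lte_fin ax.
apply: le_Rintegral => //.
- exact: (integrable_norm ie).
- by apply/integrable_itvcc/continuous_subspaceT => t; exact: cvg_cst.
- move=> t; rewrite /= in_itv/= => /andP[a1 tx].
  by apply: logtan_error_le => //; rewrite a1 (le_trans tx).
Qed.

Lemma Rintegral_ln_tan_itv a x : 0 < a -> a < x -> x <= pi / 4 ->
  \int[mu]_(t in `[a, x]) ln (tan t) = odd_clausen a - odd_clausen x.
Proof.
move=> a0 ax x1; set I := Rintegral _ _ _.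
have cC : series (odd_clausen_term a) K.+1 - series (odd_clausen_term x) K.+1
   @[K --> \oo] --> odd_clausen a - odd_clausen x.
  by apply: cvgB; rewrite (cvg_shiftS (series _)); exact: cvg_odd_clausen.
have cI : series (odd_clausen_term a) K.+1 - series (odd_clausen_term x) K.+1
   @[K --> \oo] --> I.
  pose M : R := 2 / sin (2 * a) ^+ 2 * (x - a).
  have M0 : M * harmonic K @[K --> \oo] --> (0 : R).
    have : M * harmonic K @[K --> \oo] --> (M * 0 : R).
      by apply: cvgMr; exact: cvg_harmonic.
    by rewrite mulr0.
  apply/cvgrPdist_le => e e0.
  have /cvgrPdist_le /(_ e e0) := M0.
  apply: filterS => K; rewrite sub0r normrN => /(le_trans (ler_norm _)).
  apply: le_trans; rewrite /I.
  apply: (le_trans (Rintegral_ln_tan_approx _ a0 ax x1)) => //.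
  by rewrite /M /= invfM le_eqVlt; apply/orP; left; apply/eqP; ring.
exact: (cvg_unique _ cI cC).
Qed.

Lemma ln_tan_le0 x : 0 < x <= pi / 4 -> ln (tan x) <= 0.
Proof.
move=> x01; have := x01 => /andP[x0 x1]; apply: ln_le0.
have p0 := @pi_gt0 R.
rewrite -tan_piquarter leNgt ltr_tan -?leNgt// in_itv/=; apply/andP; split; lra.
Qed.

(** Near [0] the integrand has constant sign, so monotone convergence along the
    segments [1 / (n + 1), x] gives the integral without a separate proof of
    integrability, and the lower boundary terms tend to [0]. *)
Lemma Rintegral_ln_tan x : 0 < x <= pi / 4 ->
  \int[mu]_(t in `[0, x]) ln (tan t) = - odd_clausen x.
Proof.
move=> /andP[x0 x1].
pose f t : \bar R := (ln (tan t))%:E.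
pose F n := [set` Interval (BLeft (0 + n.+1%:R^-1 : R)) (BRight x)].
have FE : `]0, x]%classic = \bigcup_n F n by rewrite itv_open_bnd_bigcup.
have f0 n t : F n t -> (f t <= 0)%E.
  rewrite /F /= in_itv/= add0r => /andP[nt tx]; rewrite lee_fin.
  by apply: ln_tan_le0; rewrite (lt_le_trans _ nt)//= (le_trans tx).
have ndF : nondecreasing_seq F.
  apply/nondecreasing_seqP => n; rewrite subsetEset => t.
  rewrite /F /= !in_itv/= !add0r => /andP[nt ->]; rewrite andbT.
  by apply: le_trans nt; rewrite lef_pV2 ?posrE// ler_nat.
have mf n : measurable_fun (F n) (fun t : R => ln (tan t)).
  rewrite /F add0r; apply: subspace_continuous_measurable_fun => //.
  by apply: continuous_ln_tan_within; apply: subset_itv; rewrite bnd_simp.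
have cF : (\int[mu]_(t in F n) f t)%E @[n --> \oo] -->
    (\int[mu]_(t in `]0%R, x]) f t)%E.
  rewrite FE; apply: le0_nondecreasing_set_cvg_integral => // n.
    exact: measurable_itv.
  by apply: measurableT_comp => //; exact: mf.
(* The equality with the integral over the segment holds once
   1 / (n + 1) < x; before that the segment may be empty. *)
have cE : (\int[mu]_(t in F n) f t)%E @[n --> \oo] --> (- odd_clausen x)%:E.
  have h0 : odd_clausen n.+1%:R^-1 @[n --> \oo] --> (0 : R).
    exact: (cvg_comp (@harmonic R) _ (@cvg_harmonic R) odd_clausen_cvg0).
  have h : (odd_clausen n.+1%:R^-1 - odd_clausen x)%:E @[n --> \oo]
      --> (- odd_clausen x)%:E.
    apply/cvg_EFin; first by near=> n.
    rewrite -[X in _ --> X]add0r; apply: cvgB => //; exact: cvg_cst.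
  apply: cvg_trans h; apply: near_eq_cvg.
  have /cvgr_lt /(_ _ x0) := @cvg_harmonic R.
  apply: filterS => n nx.
  rewrite -Rintegral_ln_tan_itv//= /Rintegral.
  rewrite fineK /F ?add0r//.
  apply: integrable_fin_num => //.
  apply/integrable_itvcc/continuous_ln_tan_within/subset_itv;
    by rewrite bnd_simp.
have E : (\int[mu]_(t in `]0%R, x]) f t = (- odd_clausen x)%:E)%E.
  exact: (cvg_unique _ cF cE).
rewrite /Rintegral -integral_itv_obnd_cbnd ?E//.
apply: measurableT_comp => //; apply: subspace_continuous_measurable_fun => //.
by apply: continuous_ln_tan_within; apply: subset_itvl; rewrite bnd_simp.
Unshelve. all: by end_near. Qed.

End Integral.

(** * Sums over the sample points *)

Section Distribution.
Context {R : realType}.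
Implicit Types (n k M : nat).

Definition catalan_series : R^nat :=
  series (fun k => (-1) ^+ k / (2 * k%:R + 1) ^+ 2).

Lemma odd_clausen_term_piquarter k :
  odd_clausen_term (pi / 4) k = (-1) ^+ k / (2 * k%:R + 1) ^+ 2 :> R.
Proof.
rewrite /odd_clausen_term -sin_odd_pihalf; congr (sin _ / _).
by field.
Qed.

Lemma catalanE : catalan R = odd_clausen (pi / 4).
Proof.
rewrite /catalan /odd_clausen; congr (limn (series _)).
by apply: funext => k; rewrite odd_clausen_term_piquarter.
Qed.

Lemma cvg_catalan_series : catalan_series @ \oo --> catalan R.
Proof.
rewrite catalanE /catalan_series.
under eq_fun do rewrite -odd_clausen_term_piquarter.
exact: cvg_odd_clausen.
Qed.

Definition sample_point n j : R := (2 * j%:R - 1) / (8 * n%:R + 4) * pi.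

(** The generic value of the alternating sine sum, corrected at the indices with
    [2 n + 1] dividing [2 k + 1]. Since the sign [(-1) ^ k] factors out in both
    cases, the sum over the sample points reproduces the terms of the series of
    [catalan]. *)
Lemma sum_odd_clausen_term n k :
  \sum_(1 <= j < n.+1) (-1) ^+ j * odd_clausen_term (sample_point n j) k =
  (-1) ^+ n / 2 * ((-1) ^+ k / (2 * k%:R + 1) ^+ 2) -
  (if (2 * n + 1 %| 2 * k + 1)%N then
    (-1) ^+ n * (n%:R + 1 / 2) * ((-1) ^+ k / (2 * k%:R + 1) ^+ 2) else 0).
Proof.
have N0 := @odd_gt0 R n.
set D := (2 * k%:R + 1) ^+ 2.
pose A j : R := (-1) ^+ j *
  sin ((2 * k%:R + 1) * (2 * j%:R - 1) * (pi / (2 * (2 * n%:R + 1)))).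
transitivity ((\sum_(1 <= j < n.+1) A j) / D).
  rewrite mulr_suml; apply: eq_bigr => j _.
  rewrite /A /odd_clausen_term -/D mulrA; congr (_ * sin _ / _).
  by rewrite /sample_point; field; rewrite !gt_eqF//; lra.
case: ifPn => [/dvdnP[q kq]|ndvd]; last first.
  by rewrite /A alternating_sin_sum_generic// subr0; ring.
have qE : q = (2 * q./2 + 1)%N.
  have oq : odd q.
    have : odd (2 * k + 1) by rewrite oddD oddM.
    by rewrite kq oddM => /andP[].
  by rewrite -[LHS](odd_double_half q) oq -mul2n addnC.
set i := q./2 in qE.
have kE : k = (n + (2 * n + 1) * i)%N by move: kq; rewrite qE; nia.
have -> : \sum_(1 <= j < n.+1) A j = - n%:R * (-1) ^+ i.
  rewrite -alternating_sin_sum_multiple; apply: eq_bigr => j _.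
  rewrite /A; congr (_ * sin _).
  have -> : 2 * k%:R + 1 = (2 * n%:R + 1) * (2 * i%:R + 1) :> R.
    by rewrite kE natrD !natrM natrD natrM; ring.
  by field; rewrite gt_eqF.
have -> : (-1) ^+ k = (-1) ^+ n * (-1) ^+ i :> R.
  by rewrite kE exprD exprM exprD exprM sqrrN !expr1n mul1r.
have s2 : (-1) ^+ n * (-1) ^+ n = 1 :> R by rewrite -expr2 sqrr_sign.
transitivity (- n%:R * ((-1) ^+ n * (-1) ^+ n) * (-1) ^+ i / D).
  by rewrite s2 mulr1.
field.
by rewrite expf_neq0// gt_eqF// odd_gt0.
Qed.

(** For [k = n + N * i] with [N = 2 n + 1] one has [2 k + 1 = N * (2 i + 1)] and
    [(-1) ^ k = (-1) ^ n * (-1) ^ i], so the corrections form the same series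
    again, divided by [N ^ 2]. Stopping at a multiple of [N] makes this
    self-similarity exact for partial sums. *)
Lemma sum_odd_clausen_series n M :
  \sum_(1 <= j < n.+1) (-1) ^+ j *
    series (odd_clausen_term (sample_point n j)) ((2 * n + 1) * M) =
  (-1) ^+ n / 2 * catalan_series ((2 * n + 1) * M) -
  1 / (2 * (2 * n%:R + 1)) * catalan_series M.
Proof.
have N0 := @odd_gt0 R n.
rewrite /catalan_series /series/=.
under eq_bigr do rewrite mulr_sumr.
rewrite exchange_big/=.
under eq_bigr do rewrite sum_odd_clausen_term.
rewrite sumrB -mulr_sumr; congr (_ - _).
rewrite -big_mkcond/= sum_odd_multiples mulr_sumr; apply: eq_bigr => i _.
have -> : (-1) ^+ (n + (2 * n + 1) * i) = (-1) ^+ n * (-1) ^+ i :> R.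
  by rewrite exprD exprM exprD exprM sqrrN !expr1n mul1r.
have -> : 2 * (n + (2 * n + 1) * i)%:R + 1 =
    (2 * n%:R + 1) * (2 * i%:R + 1) :> R.
  by rewrite natrD !natrM natrD natrM; ring.
transitivity ((-1) ^+ n * (-1) ^+ n * (n%:R + 1 / 2) * (-1) ^+ i /
    ((2 * n%:R + 1) * (2 * i%:R + 1)) ^+ 2 : R); first by ring.
rewrite -expr2 sqrr_sign mul1r; field.
by rewrite !gt_eqF// odd_gt0.
Qed.

Lemma sum_odd_clausen n :
  \sum_(1 <= j < n.+1) (-1) ^+ j * odd_clausen (sample_point n j) =
  ((-1) ^+ n / 2 - 1 / (2 * (2 * n%:R + 1))) * catalan R.
Proof.
have N0 : (0 < 2 * n + 1)%N by rewrite addn1.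
have Ny : ((2 * n + 1) * M)%N @[M --> \oo] --> \oo.
  apply/cvgnyPge => A; exists A => // M /= AM.
  by rewrite (leq_trans AM)// leq_pmull.
have sub (u : R^nat) l :
    u @ \oo --> l -> u ((2 * n + 1) * M)%N @[M --> \oo] --> l.
  by move=> ul; exact: (cvg_comp _ _ Ny ul).
have L : \sum_(1 <= j < n.+1) (-1) ^+ j *
    series (odd_clausen_term (sample_point n j)) ((2 * n + 1) * M)
    @[M --> \oo] -->
    \sum_(1 <= j < n.+1) (-1) ^+ j * odd_clausen (sample_point n j).
  apply: cvg_big => [|j _]; first exact: add_continuous.
  by apply: cvgMr; apply: sub; exact: cvg_odd_clausen.
have Rt : (-1) ^+ n / 2 * catalan_series ((2 * n + 1) * M) -
    1 / (2 * (2 * n%:R + 1)) * catalan_series M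
    @[M --> \oo] -->
    ((-1) ^+ n / 2) * catalan R - (1 / (2 * (2 * n%:R + 1))) * catalan R.
  apply: cvgB; apply: cvgMr; last exact: cvg_catalan_series.
  by apply: sub; exact: cvg_catalan_series.
move: L; under eq_cvg do rewrite sum_odd_clausen_series; move=> L.
by rewrite mulrBl; exact: (cvg_unique _ L Rt).
Qed.

Lemma logtan_integralE (r : R) : 0 < r <= 1 / 4 ->
  logtan_integral r = - odd_clausen (r * pi).
Proof.
move=> /andP[r0 r1]; rewrite /logtan_integral Rintegral_ln_tan//.
have p0 := @pi_gt0 R.
by rewrite mulr_gt0//= [leRHS](_ : _ = 1 / 4 * pi); [rewrite ler_pM2r|field].
Qed.

End Distribution.

Theorem theorem5 (R : realType) (n : nat) (hn : odd n) :
  catalan R = - logtan_integral (1 / 4) /\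
  - logtan_integral (1 / 4 : R) =
    (2 * n%:R + 1) / (n%:R + 1) *
      \sum_(1 <= j < n.+1)
        (-1) ^+ j * logtan_integral ((2 * j%:R - 1) / (8 * n%:R + 4)).
Proof.
have G : - logtan_integral (1 / 4 : R) = catalan R.
  rewrite logtan_integralE ?lexx ?divr_gt0// opprK catalanE; congr odd_clausen.
  by field.
split; first by rewrite G.
rewrite G.
have n0 : 0 <= n%:R :> R by [].
have -> : \sum_(1 <= j < n.+1) (-1) ^+ j *
    logtan_integral ((2 * j%:R - 1) / (8 * n%:R + 4)) =
    - \sum_(1 <= j < n.+1) (-1) ^+ j * odd_clausen (sample_point n j) :> R.
  rewrite -sumrN; apply: eq_big_nat => j /andP[j1 jn].
  have j1R : 1 <= j%:R :> R by rewrite ler1n.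
  have jnR : j%:R <= n%:R :> R by rewrite ler_nat -ltnS.
  rewrite logtan_integralE ?mulrN// divr_gt0/=; try lra.
  by rewrite ler_pdivrMr; lra.
rewrite sum_odd_clausen -signr_odd hn expr1.
by field; rewrite !gt_eqF//; lra.
Qed.
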